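(* Different points in $(0,1)$ have non-isomorphic pointed marked Schreier graphs: if $x,y\in(0,1)$ and $x\ne y$, then the pointed marked graphs $\Gamma_x$ (with base vertex $x$) and $\Gamma_y$ (with base vertex $y$) are not isomorphic.
   Context: Thompson's group $F$ is the group of all strictly increasing piecewise linear homeomorphisms of $[0,1]$ that are differentiable except at finitely many dyadic rationals and whose slopes are integer powers of $2$; products are read left to right, $(fg)(x)=g(f(x))$, and $x^f:=f(x)$. It is generated by $x_0,x_1$, where $x_0(t)=t/2$ on $[0,\frac12]$, $t-\frac14$ on $[\frac12,\frac34]$, $2t-1$ on $[\frac34,1]$; and $x_1(t)=t$ on $[0,\frac12]$, $\frac t2+\frac14$ on $[\frac12,\frac34]$, $t-\frac18$ on $[\frac34,\frac78]$, $2t-1$ on $[\frac78,1]$. The Schreier graph $\Gamma_x$ of the action of $F$ on the orbit of $x$ has the points of the orbit as vertices, with a directed edge labeled $s\in\{x_0,x_1\}$ from $y$ to $z$ iff $y^s=z$. An isomorphism of pointed marked graphs is a graph isomorphism preserving edge orientation, the edge labels $x_0,x_1$, and the base vertex (names of vertices are not part of the structure). *)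

(* Defs.v *)
From HB Require Import structures.
From mathcomp Require Import all_boot all_order all_algebra.
From mathcomp Require Import all_classical all_reals all_analysis.
Import Order.TTheory GRing.Theory Num.Theory.
Import numFieldNormedType.Exports.

Set Implicit Arguments.
Unset Strict Implicit.
Unset Printing Implicit Defensive.

Local Open Scope classical_set_scope.
Local Open Scope ring_scope.

(* A self-map of [0, 1] is represented by a function R -> R whose values
   outside [0, 1] are irrelevant. *)

Definition unit_homeomorphism (R : realType) (f : R -> R) : Prop :=
  set_bij `[0, 1] `[0, 1] f /\
  exists g : R -> R,
    [/\ {in `[0, 1], cancel f g},
        {within `[0, 1], continuous f} &
        {within `[0, 1], continuous g}].

(* [0 :: s] lists the subdivision points 0 = a_0 < a_1 < ... < a_n = 1, so
   that the i-th piece is [(0 :: s)_i, s_i]; [S] is the set of slopes allowed. *)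
Definition piecewise_linear (R : realType) (S : set R) (f : R -> R) : Prop :=
  exists2 s : seq R, itv_partition 0 1 s &
    forall i : nat, (i < size s)%N ->
      exists a b : R, S a /\
        {in `[(0 :: s)`_i, s`_i], forall t, f t = a * t + b}.

Definition dyadic (R : realType) : set R :=
  [set t | exists (m : int) (n : nat), t = m%:~R / 2 ^+ n].

Definition powers_of_2 (R : realType) : set R :=
  [set a | exists k : int, a = 2 ^ k].

Definition nondifferentiable (R : realType) (f : R -> R) : set R :=
  [set t | 0 < t < 1 /\ ~ derivable f t 1].

Definition thompsonF (R : realType) (f : R -> R) : Prop :=
  [/\ {in `[0, 1] &, {homo f : s t / s < t}},
      unit_homeomorphism f,
      piecewise_linear (@powers_of_2 R) f,
      finite_set (nondifferentiable f) &
      nondifferentiable f `<=` @dyadic R].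

Definition thompson_x0 (R : realType) (t : R) : R :=
  if t <= 1 / 2 then t / 2
  else if t <= 3 / 4 then t - 1 / 4
  else 2 * t - 1.

Definition thompson_x1 (R : realType) (t : R) : R :=
  if t <= 1 / 2 then t
  else if t <= 3 / 4 then t / 2 + 1 / 4
  else if t <= 7 / 8 then t - 1 / 8
  else 2 * t - 1.

Variant generator := X0 | X1.

Definition generator_map (R : realType) (s : generator) : R -> R :=
  match s with X0 => @thompson_x0 R | X1 => @thompson_x1 R end.

Definition thompson_orbit (R : realType) (x : R) : set R :=
  [set z | exists2 f : R -> R, thompsonF f & f x = z].

Lemma thompsonF_id (R : realType) : @thompsonF R id.
Proof.
have nd0 : nondifferentiable (@id R) = set0.
  by rewrite -subset0 => t [_ ndt]; apply: ndt; exact: derivable_id.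
have ctsid : {within `[0, 1], continuous (@id R)}.
  by apply: continuous_subspaceT => t; exact: cvg_id.
split=> //.
- split; first by split => // t /= ht; exists t.
  by exists id; split.
- exists [:: 1]; first by split => //=; rewrite ltr01.
  case=> [|//] _; exists 1, 0; split; first by exists 0; rewrite expr0z.
  by move=> t _; rewrite mul1r addr0.
- by rewrite nd0; exact: finite_set0.
- by rewrite nd0; exact: sub0set.
Qed.

Lemma thompson_orbit_refl (R : realType) (x : R) : x \in thompson_orbit x.
Proof. by apply/mem_set; exists id => //; exact: thompsonF_id. Qed.

(* A graph with at most one edge of each label from one vertex to another, so
   that an isomorphism is determined by its action on vertices. *)
Record pointed_marked_graph := PointedMarkedGraph {
  vertex : Type;
  edge : generator -> vertex -> vertex -> Prop;
  base : vertex
}.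

Definition pmg_isomorphic (G H : pointed_marked_graph) : Prop :=
  exists phi : vertex G -> vertex H,
    [/\ bijective phi,
        forall s u v, edge s u v <-> edge s (phi u) (phi v) &
        phi (base G) = base H].

Definition schreier_graph (R : realType) (x : R) : pointed_marked_graph :=
  {| vertex := set_type (thompson_orbit x);
     edge := fun s u v => generator_map s (val u) = val v;
     base := SigSub (thompson_orbit_refl x) |}.

(* Main.v *)
Require Import Defs.
From HB Require Import structures.
From mathcomp Require Import all_boot all_order all_algebra.
From mathcomp Require Import all_classical all_reals all_analysis.
From mathcomp Require Import ring lra.
Import Order.TTheory GRing.Theory Num.Theory.
Import numFieldNormedType.Exports.
Set Implicit Arguments.
Unset Strict Implicit.
Unset Printing Implicit Defensive.
Local Open Scope classical_set_scope.
Local Open Scope ring_scope.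

(** A vertex of a Schreier graph can be watched through a single bit: for
    [0 < t < 1] the generator [x1] fixes [t] exactly when [t <= 1/2], so whether
    a vertex carries a loop labelled [x1] says on which side of [1/2] it lies.
    Suppose an isomorphism sends [x] to [y], and call [a] and [b] linked when
    some vertex [a] of the first graph is sent to the vertex [b] of the second.
    Since edges are preserved and the generators are injective, linked points
    stay linked when the same word in [x0], [x1] and their inverses is applied
    to both, and linked points always lie on the same side of [1/2].

    This forces [a = b] because [F] can magnify ([double_gap]): comparing the
    sides of [1/2] after applying [x0^-1], nothing, [x0], or [x1^-1] followed by
    [x0] shows that [a] and [b] lie in the same one of the five intervals into
    which [1/4], [1/2], [5/8], [3/4] cut [(0, 1)], and on each of these some
    short word is affine of slope [2].  So a linked pair with gap [d] yields a linked pair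
    with gap [2 d], which inside [(0, 1)] is possible for ever only if [d = 0]
    ([inseparable_eq]).

    To apply words at all, orbits must be closed under the generators and their
    inverses, i.e. [F] must be closed under composition ([thompsonF_comp]).  The
    delicate clause is that breakpoints of [g \o f] are dyadic: such a point may
    be the preimage under [f] of a breakpoint of [g].  It is dyadic because
    every affine piece [al * t + be] of [f] has a dyadic offset [be]: the first
    offset is [f 0 = 0], and an offset can change only at a point where [f] is
    not differentiable, hence at a dyadic point ([next_offset_dyadic]). *)

(** * Dyadic numbers and powers of two *)

Section Dyadic.
Variable R : realType.
Implicit Types u v a : R.

Lemma dyadicD u v : dyadic u -> dyadic v -> dyadic (u + v).
Proof.
move=> [m [n ->]] [p [q ->]]; exists (m * 2 ^+ q + p * 2 ^+ n), (n + q)%N.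
have h k : (2 : R) ^+ k != 0 by rewrite expf_neq0// pnatr_eq0.
by rewrite rmorphD !rmorphM !rmorphXn/= exprD; field; rewrite !h.
Qed.

Lemma dyadicM u v : dyadic u -> dyadic v -> dyadic (u * v).
Proof.
move=> [m [n ->]] [p [q ->]]; exists (m * p), (n + q)%N.
have h k : (2 : R) ^+ k != 0 by rewrite expf_neq0// pnatr_eq0.
by rewrite rmorphM/= exprD; field; rewrite !h.
Qed.

Lemma dyadic_int (m : int) : dyadic (m%:~R : R).
Proof. by exists m, 0%N; rewrite expr0 divr1. Qed.

Lemma dyadicN u : dyadic u -> dyadic (- u).
Proof.
move=> du; rewrite -mulN1r; apply: dyadicM => //.
exact: (dyadic_int (-1)).
Qed.

Lemma dyadicB u v : dyadic u -> dyadic v -> dyadic (u - v).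
Proof. by move=> du /dyadicN; exact: dyadicD. Qed.

Lemma powers_of_2_dyadic a : powers_of_2 a -> dyadic a.
Proof.
case=> [[n|n]] ->.
  by exists (2 ^+ n)%R, 0%N; rewrite expr0 divr1 rmorphXn/= -exprnP.
by exists 1, n.+1; rewrite mul1r NegzE exprnN.
Qed.

Lemma powers_of_2V a : powers_of_2 a -> powers_of_2 a^-1.
Proof. by move=> [k ->]; exists (- k); rewrite -invr_expz. Qed.

Lemma powers_of_2M a b :
  powers_of_2 a -> powers_of_2 b -> @powers_of_2 R (a * b).
Proof.
by move=> [k ->] [l ->]; exists (k + l); rewrite expfzDr// pnatr_eq0.
Qed.

Lemma powers_of_2_gt0 a : powers_of_2 a -> 0 < a.
Proof. by move=> [k ->]; rewrite exprz_gt0. Qed.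

End Dyadic.

(** * Piecewise linear maps as an inductive predicate *)

Section PL.
Variable R : realType.
Implicit Types (f g : R -> R) (a b c : R).

Definition affine_on f a b (al be : R) :=
  {in `[a, b], forall t, f t = al * t + be}.

Definition pow2_affine_on f a b := exists al be,
  powers_of_2 al /\ affine_on f a b al be.

(** Piecewise linearity by induction on the list of pieces, which turns the
    common refinement needed for compositions into structural inductions. *)
Inductive pow2_pl f a b : Prop :=
| pow2_pl_piece : a < b -> pow2_affine_on f a b -> pow2_pl f a b
| pow2_pl_cons c :
    a < c -> pow2_affine_on f a c -> pow2_pl f c b -> pow2_pl f a b.

Lemma pow2_pl_lt f a b : pow2_pl f a b -> a < b.
Proof. by elim=> // a' b' c ac _ _; exact: lt_trans. Qed.

Lemma pow2_pl_cat f a b c : pow2_pl f a b -> pow2_pl f b c -> pow2_pl f a c.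
Proof.
elim=> [a' b' ab p|a' b' d ad p _ IH] h; first exact: (@pow2_pl_cons _ _ _ b').
by apply: (@pow2_pl_cons _ _ _ d) => //; exact: IH.
Qed.

Lemma affine_sub f a b a' b' al be : a <= a' -> b' <= b ->
  affine_on f a b al be -> affine_on f a' b' al be.
Proof.
move=> aa bb h t; rewrite in_itv/= => /andP[? ?]; apply: h.
rewrite in_itv/=; apply/andP.
by split; [exact: le_trans aa _|exact: le_trans bb].
Qed.

Lemma pow2_pl_sub f a b a' b' :
  pow2_pl f a b -> a <= a' -> a' < b' -> b' <= b -> pow2_pl f a' b'.
Proof.
move=> h; elim: h a' => {a b}
  [a b ab [al [be [S p]]]|a b c ac [al [be [S p]]] _ IH] a' aa ab' bb.
  by apply: pow2_pl_piece => //; exists al, be; split=> //; exact: affine_sub p.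
have [ca|a'c] := leP c a'; first exact: IH.
have [b'c|cb'] := leP b' c.
  by apply: pow2_pl_piece => //; exists al, be; split=> //; exact: affine_sub p.
apply: (@pow2_pl_cons _ _ _ c) => //; last exact: IH.
by exists al, be; split=> //; exact: affine_sub p.
Qed.

(** An affine [f] pulls the subdivision points of [g] back one at a time. *)
Lemma pow2_pl_comp_affine f g a b al be : powers_of_2 al ->
  affine_on f a b al be -> pow2_pl g (f a) (f b) -> a < b ->
  pow2_pl (g \o f) a b.
Proof.
move=> S p h ab; have al0 := powers_of_2_gt0 S.
move Eu : (f a) h => u h; move Ev : (f b) h => v h.
rewrite p in Eu; last by rewrite in_itv/= lexx ltW.
rewrite p in Ev; last by rewrite in_itv/= lexx ltW.
elim: h a ab p Eu Ev => {u v}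
  [u v uv [al' [be' [S' q]]]|u v w uw [al' [be' [S' q]]] wv IH] a ab p Eu Ev.
  apply: pow2_pl_piece => //; exists (al' * al), (al' * be + be'); split.
    exact: powers_of_2M.
  move=> t tab /=; rewrite q p//; first ring.
  move: tab; rewrite !in_itv/= -Eu -Ev !lerD2r !ler_pM2l//.
set c := (w - be) / al.
have cw : al * c + be = w by rewrite /c; field; rewrite gt_eqF.
have ac : a < c by rewrite -(ltr_pM2l al0) -(ltrD2r be) Eu cw.
have cb : c < b.
  by rewrite -(ltr_pM2l al0) -(ltrD2r be) Ev cw; exact: pow2_pl_lt wv.
apply: (@pow2_pl_cons _ _ _ c) => //; last first.
  by apply: IH => //; exact: affine_sub (ltW ac) _ p.
exists (al' * al), (al' * be + be'); split; first exact: powers_of_2M.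
move=> t tac /=.
rewrite (affine_sub (lexx a) (ltW cb) p)// q; first ring.
by move: tac; rewrite !in_itv/= -Eu -cw !lerD2r !ler_pM2l.
Qed.

Lemma pow2_affine_on_lt f a b : a < b -> pow2_affine_on f a b -> f a < f b.
Proof.
move=> ab [al [be [S p]]]; rewrite !p ?in_itv/= ?lexx ?(ltW ab)//.
by rewrite ltrD2r ltr_pM2l// powers_of_2_gt0.
Qed.

Lemma pow2_pl_lt_im f a b : pow2_pl f a b -> f a < f b.
Proof.
elim=> {}a {}b; first exact: pow2_affine_on_lt.
by move=> c ac p _; exact: lt_trans (pow2_affine_on_lt ac p).
Qed.

Lemma pow2_pl_comp f g a b :
  pow2_pl f a b -> pow2_pl g (f a) (f b) -> pow2_pl (g \o f) a b.
Proof.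
elim=> {a b} [a b ab [al [be [S p]]]|a b c ac pac fcb IH] h.
  exact: pow2_pl_comp_affine p h ab.
have fac := pow2_affine_on_lt ac pac; have fcb' := pow2_pl_lt_im fcb.
have [al [be [S p]]] := pac.
apply: (@pow2_pl_cat _ _ c).
  by apply: pow2_pl_comp_affine S p _ ac; exact: pow2_pl_sub h _ fac (ltW fcb').
by apply: IH; apply: pow2_pl_sub h (ltW fac) fcb' _.
Qed.

Lemma pow2_pl_partition f a b : pow2_pl f a b <->
  a < b /\ exists2 s : seq R, itv_partition a b s &
    forall i : nat, (i < size s)%N -> pow2_affine_on f (a :: s)`_i s`_i.
Proof.
split.
  elim=> {a b} [a b ab p|a b c ac p cb [_ [s [ps /eqP ls] hs]]].
    split=> //; exists [:: b]; first by split; rewrite //= ab.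
    by case.
  split; first exact: lt_trans ac (pow2_pl_lt cb).
  exists (c :: s); first by split; rewrite /= ?ac ?ls.
  by case=> [//|i] /= /hs.
move=> [ab [s [ps /eqP ls] hs]].
elim: s a ab ps ls hs => [|c s IH] a ab /=.
  by move=> _ ab'; rewrite ab' ltxx in ab.
move=> /andP[ac cs] lb hs; have h0 : pow2_affine_on f a c := hs 0%N isT.
case: s cs lb hs IH => [|d s] cs lb hs IH.
  by apply: pow2_pl_piece => //; rewrite -lb.
apply: (@pow2_pl_cons _ _ _ c) => //; apply: IH => //.
  rewrite -lb; apply: (allP (order_path_min lt_trans cs)).
  exact: (mem_last d s).
by move=> i; exact: (hs i.+1).
Qed.

Lemma piecewise_linear_pow2P f :
  piecewise_linear (@powers_of_2 R) f <-> pow2_pl f 0 1.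
Proof.
split=> h; first by apply/pow2_pl_partition; split; [exact: ltr01|exact: h].
by case/pow2_pl_partition: h.
Qed.

End PL.

(** * Composition in Thompson's group *)

Section Homeo.
Variable R : realType.
Implicit Types (f g : R -> R).

(** Continuity comes for free: an increasing map of an interval onto an
    interval is continuous, and so is its inverse. *)
Lemma unit_homeomorphism_increasing f g :
  {in `[0, 1] &, {homo f : s t / s < t}} ->
  {homo f : t / t \in `[0, 1]} -> {homo g : t / t \in `[0, 1]} ->
  {in `[0, 1], cancel g f} -> unit_homeomorphism f.
Proof.
move=> fi f01 g01 gK.
have fm : {in `[0, 1] &, {mono f : s t / s <= t}}.
  exact: le_mono_in.
have finj : {in `[0, 1] &, injective f} by exact: inc_inj_in.
have fK : {in `[0, 1], cancel f g}.
  by move=> t t01; apply: finj; rewrite ?gK ?f01 ?g01// f01.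
have gm : {in `[0, 1] &, {mono g : s t / s <= t}}.
  by move=> s t s01 t01; rewrite -fm ?g01// !gK.
have sub01 (h : R -> R) : {homo h : t / t \in `[0, 1]} ->
    {subset `[h 0, h 1] <= `[0, 1]}.
  move=> h01 t; have := h01 0; have := h01 1.
  rewrite !in_itv/= !lexx !ler01 => /(_ isT) /andP[_ h1] /(_ isT) /andP[h0 _].
  by move=> /andP[ht th]; rewrite (le_trans h0 ht) (le_trans th h1).
split.
  split; first by move=> t /= /f01.
    by move=> s t; rewrite !inE; exact: finj.
  by move=> t /= t01; exists (g t); [exact: g01|exact: gK].
exists g; split=> //; apply: segment_inc_surj_continuous => //.
  by move=> t /= /(sub01 f f01) t01; exists (g t); [exact: g01|exact: gK].
by move=> t /= /(sub01 g g01) t01; exists (f t); [exact: f01|exact: fK].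
Qed.

Lemma unit_homeomorphism_inverse f : unit_homeomorphism f ->
  {homo f : t / t \in `[0, 1]} /\
  exists g, {homo g : t / t \in `[0, 1]} /\ {in `[0, 1], cancel g f}.
Proof.
move=> [[f01 _ fs] [g [fK _ _]]]; split; first exact: f01.
exists g; split; last by move=> t /fs[u /= u01 <-]; rewrite fK.
by move=> t /fs[u /= u01 <-]; rewrite fK.
Qed.

Lemma derivable_affine f a b al be t :
  affine_on f a b al be -> a < t < b -> derivable f t 1.
Proof.
move=> p tab; apply: (@near_eq_derivable _ _ _ (fun s => al * s + be)).
  have : t \in `]a, b[ by rewrite in_itv.
  move=> /near_in_itvoo; apply: filterS => s sab; apply/esym/p.
  exact: subset_itv_oo_cc.
by apply: derivableD => //; apply: derivableM.
Qed.

(** The difference quotient at [c] is constant on either side, so its two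
    one-sided limits are the two slopes. *)
Lemma derivable_slope_eq f l c r al be al' be' : l < c -> c < r ->
  affine_on f l c al be -> affine_on f c r al' be' ->
  derivable f c 1 -> al = al'.
Proof.
move=> lc cr p q df.
have L : h^-1 *: ((f \o shift c) (h *: 1) - f c) @[h --> 0^'-] --> al.
  apply: cvg_near_cst; near=> h.
  have h0 : h < 0 by near: h; exact: nbhs_left_lt.
  have lh : l - c < h by near: h; apply: nbhs_left_gt; rewrite subr_lt0.
  rewrite /= !p ?in_itv/= ?lexx ?(ltW lc)//.
    by rewrite /GRing.scale/= mulr1; field; rewrite lt_eqF.
  by rewrite /GRing.scale/= mulr1; apply/andP; split; lra.
have L' : h^-1 *: ((f \o shift c) (h *: 1) - f c) @[h --> 0^'+] --> al'.
  apply: cvg_near_cst; near=> h.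
  have h0 : 0 < h by near: h; exact: nbhs_right_gt.
  have lh : h < r - c by near: h; apply: nbhs_right_lt; rewrite subr_gt0.
  rewrite /= !q ?in_itv/= ?lexx ?(ltW cr)//.
    by rewrite /GRing.scale/= mulr1; field; rewrite gt_eqF.
  by rewrite /GRing.scale/= mulr1; apply/andP; split; lra.
rewrite (cvg_unique (@Rhausdorff R) L (cvg_dnbhs_at_left df)).
exact: (cvg_unique (@Rhausdorff R) (cvg_dnbhs_at_right df) L').
Unshelve. all: by end_near. Qed.

(** Both pieces agree at [c], so the offsets differ by [(al - al') * c]; either
    [f] is differentiable at [c] and the slopes agree, or [c] is dyadic. *)
Lemma next_offset_dyadic f l c r al be al' be' :
  nondifferentiable f `<=` @dyadic R ->
  0 <= l -> l < c -> c < r -> r <= 1 ->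
  powers_of_2 al -> dyadic be -> affine_on f l c al be ->
  powers_of_2 al' -> affine_on f c r al' be' -> dyadic be'.
Proof.
move=> nd l0 lc cr r1 S D p S' q.
have fc : al * c + be = al' * c + be'.
  by rewrite -p ?in_itv/= ?lexx ?ltW// -q ?in_itv/= ?lexx ?ltW.
have [df|ndf] := pselect (derivable f c 1).
  by move: fc; rewrite (derivable_slope_eq lc cr p q df) => /addrI <-.
have -> : be' = al * c + be - al' * c by rewrite fc addrAC subrr add0r.
have Dc : dyadic c.
  by apply: nd; split=> //; rewrite (le_lt_trans l0 lc) (lt_le_trans cr r1).
by apply: dyadicB; [apply: dyadicD => //|]; apply: dyadicM => //;
  exact: powers_of_2_dyadic.
Qed.

Definition dyadic_affine_value f (t : R) := exists al be,
  [/\ powers_of_2 al, dyadic be & f t = al * t + be].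

(** Propagates dyadic offsets from left to right; the piece on [[l, c]] is the
    last one already treated. *)
Lemma pow2_pl_dyadic_values f l c r al be : nondifferentiable f `<=` @dyadic R ->
  0 <= l -> l < c -> powers_of_2 al -> dyadic be -> affine_on f l c al be ->
  pow2_pl f c r -> r <= 1 -> forall t, c <= t <= r -> dyadic_affine_value f t.
Proof.
move=> nd l0 lc S D p h.
elim: h l al be l0 lc S D p => {c r}
  [c r cr|c r d cd] [al' [be' [S' q]]].
  move=> l al be l0 lc S D p r1 t ctr; exists al', be'; split=> //.
    exact: next_offset_dyadic p S' q.
  exact: q.
move=> dr IH l al be l0 lc S D p r1 t /andP[ct tr].
have D' : dyadic be'.
  apply: next_offset_dyadic p S' q => //.
  exact: le_trans (ltW (pow2_pl_lt dr)) r1.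
have [td|dt] := leP t d; last first.
  apply: (IH c al' be') => //; first exact: le_trans l0 (ltW lc).
  by rewrite (ltW dt).
by exists al', be'; split=> //; apply: q; rewrite in_itv/= ct.
Qed.

Lemma thompsonF_ends f : thompsonF f -> f 0 = 0 /\ f 1 = 1.
Proof.
move=> [fi /unit_homeomorphism_inverse[f01 [g [g01 gK]]] _ _ _].
have fm : {in `[0, 1] &, {mono f : s t / s <= t}} by exact: le_mono_in.
have i0 : (0 : R) \in `[0, 1] by rewrite in_itv/= lexx ler01.
have i1 : (1 : R) \in `[0, 1] by rewrite in_itv/= lexx ler01.
have := f01 0 i0; have := f01 1 i1; rewrite !in_itv/= => /andP[_ f1] /andP[f0 _].
split; apply/eqP; rewrite eq_le ?f1 ?f0 ?andbT.
  by rewrite -[leRHS]gK// fm ?g01//; move: (g01 0 i0); rewrite in_itv/= => /andP[].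
by rewrite -[leLHS]gK// fm ?g01//; move: (g01 1 i1); rewrite in_itv/= => /andP[].
Qed.

Lemma thompsonF_dyadic_values f t : thompsonF f -> 0 <= t <= 1 ->
  dyadic_affine_value f t.
Proof.
move=> Ff /andP[t0 t1]; have [f0 _] := thompsonF_ends Ff.
have [_ _ /piecewise_linear_pow2P h _ nd] := Ff.
have D0 c al be : 0 < c -> affine_on f 0 c al be -> dyadic be.
  move=> c0 /(_ 0); rewrite in_itv/= lexx (ltW c0) f0 mulr0 add0r => /(_ isT) <-.
  exact: (dyadic_int R 0).
case: h => [_|c c0] [al [be [S p]]].
  by exists al, be; split=> //; [exact: D0 p|apply: p; rewrite in_itv/= t0].
move=> h; have [tc|ct] := leP t c.
  by exists al, be; split=> //; [exact: D0 p|apply: p; rewrite in_itv/= t0].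
by apply: pow2_pl_dyadic_values S (D0 _ _ _ c0 p) p h _ _ _ => //; rewrite (ltW ct).
Qed.

Lemma thompsonF_reflects_dyadic f t : thompsonF f -> 0 <= t <= 1 ->
  dyadic (f t) -> dyadic t.
Proof.
move=> Ff /(thompsonF_dyadic_values Ff)[al [be [S D ->]]] D'.
have -> : t = al^-1 * (al * t + be - be).
  by field; rewrite gt_eqF// powers_of_2_gt0.
apply: dyadicM; last exact: dyadicB.
exact/powers_of_2_dyadic/powers_of_2V.
Qed.

(** By the chain rule, a breakpoint of [g \o f] is a breakpoint of [f] or the
    preimage of one of [g]; such preimages are finitely many because [f] is
    injective, and dyadic because [f] reflects dyadic points. *)
Lemma thompsonF_comp f g : thompsonF f -> thompsonF g -> thompsonF (g \o f).
Proof.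
move=> Ff Fg; have [f0 f1] := thompsonF_ends Ff.
have [fi fh /piecewise_linear_pow2P fp ff fd] := Ff.
have [gi gh /piecewise_linear_pow2P gp gf gd] := Fg.
have [f01 [f' [f'01 f'K]]] := unit_homeomorphism_inverse fh.
have [g01 [g' [g'01 g'K]]] := unit_homeomorphism_inverse gh.
have fin t : 0 < t < 1 -> 0 < f t < 1.
  move=> /andP[t0 t1]; rewrite -[X in X < _]f0 -[X in _ < _ < X]f1.
  by rewrite !fi// in_itv/= ?lexx ?ler01 ?ltW.
have nd : nondifferentiable (g \o f) `<=` nondifferentiable f `|`
    (`]0, 1[ `&` f @^-1` nondifferentiable g).
  move=> t [t01 ndt].
  have [dft|] := pselect (derivable f t 1); last by left.
  right; split; first by rewrite /= in_itv.
  split; first exact: fin.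
  move=> dgt; apply: ndt; apply/derivable1_diffP/differentiable_comp;
  exact/derivable1_diffP.
split.
- by move=> s t s01 t01 st /=; apply: gi; [exact: f01|exact: f01|exact: fi].
- apply: (@unit_homeomorphism_increasing _ (f' \o g')).
  + by move=> s t s01 t01 st /=; apply: gi; [exact: f01|exact: f01|exact: fi].
  + by move=> t /f01 /g01.
  + by move=> t /g'01 /f'01.
  + by move=> t t01 /=; rewrite f'K ?g'01// g'K.
- by apply/piecewise_linear_pow2P/pow2_pl_comp; rewrite ?f0 ?f1.
- (* A right inverse [f'] of [f] turns the preimage into an image. *)
  apply: sub_finite_set nd _; rewrite finite_setU; split=> //.
  apply: (@sub_finite_set _ _ (f' @` nondifferentiable g)).
    move=> t [/= t01 ft]; exists (f t) => //.
    have i01 : t \in `[0, 1] by exact: subset_itv_oo_cc.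
    apply: (inc_inj_in (le_mono_in fi)); rewrite ?f'K//; first exact/f'01/f01.
    exact: f01.
  exact: finite_image.
- move=> t /nd[/fd//|[/= t01 /gd]].
  apply: thompsonF_reflects_dyadic => //.
  by move: t01; rewrite in_itv/= => /andP[/ltW -> /ltW ->].
Qed.

(** A criterion for explicit maps: away from the subdivision points the map is
    locally affine, so only those points can be breakpoints. *)
Lemma thompsonF_of_partition f g (s : seq R) :
  {in `[0, 1] &, {homo f : s t / s < t}} ->
  {homo f : t / t \in `[0, 1]} -> {homo g : t / t \in `[0, 1]} ->
  {in `[0, 1], cancel g f} ->
  itv_partition 0 1 s -> (forall t, t \in s -> dyadic t) ->
  (forall i, (i < size s)%N -> pow2_affine_on f (0 :: s)`_i s`_i) ->
  thompsonF f.
Proof.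
move=> fi f01 g01 gK sp sd h.
have nd : nondifferentiable f `<=` [set` s].
  move=> t [t01 ndt]; apply: contrapT => /= /negP ts; apply: ndt.
  case: sp => _ /eqP ls.
  have : forall a, a < t < 1 -> last a s = 1 ->
      (forall i, (i < size s)%N -> pow2_affine_on f (a :: s)`_i s`_i) ->
      derivable f t 1; last by move=> /(_ 0); apply.
  elim: s ts {h ls sd} => [|c s IH] /= ts a /andP[at_ t1] ls h.
    by move: at_ t1; rewrite ls => /lt_trans/[apply]; rewrite ltxx.
  move: ts; rewrite inE negb_or => /andP[tc ts].
  have [ct|{}tc] : c < t \/ t < c by apply/orP; rewrite -neq_lt eq_sym.
    apply: (IH ts c) => //; first by rewrite ct.
    by move=> i; exact: (h i.+1).
  have [al [be [_ p]]] := h 0%N isT.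
  by apply: derivable_affine p _; rewrite at_.
split=> //.
- exact: unit_homeomorphism_increasing gK.
- by exists s.
- exact: sub_finite_set nd (finite_seq s).
- by move=> t /nd; exact: sd.
Qed.

End Homeo.

(** * The generators and their inverses *)

Section Generators.
Variable R : realType.
Implicit Types (a b t : R).

Definition thompson_x0_inv t : R :=
  if t <= 1 / 4 then 2 * t
  else if t <= 1 / 2 then t + 1 / 4
  else (t + 1) / 2.

Definition thompson_x1_inv t : R :=
  if t <= 1 / 2 then t
  else if t <= 5 / 8 then 2 * t - 1 / 2
  else if t <= 3 / 4 then t + 1 / 8
  else (t + 1) / 2.

(* Nested conditionals are split from the inside out, so that every test met is
   a linear inequality that the arithmetic solver understands. *)
Local Ltac case_pieces :=
  repeat match goal with |- context [if (?u <= ?v)%R then _ else _] =>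
    lazymatch u with context [if _ then _ else _] => fail | _ => idtac end;
    case: (leP u v) => ? end.
Local Ltac pieces_lra := case_pieces; lra.

Lemma thompson_x0_invK : cancel thompson_x0_inv (@thompson_x0 R).
Proof. by move=> t; rewrite /thompson_x0_inv /thompson_x0; pieces_lra. Qed.

Lemma thompson_x0K : cancel (@thompson_x0 R) thompson_x0_inv.
Proof. by move=> t; rewrite /thompson_x0_inv /thompson_x0; pieces_lra. Qed.

Lemma thompson_x1_invK : cancel thompson_x1_inv (@thompson_x1 R).
Proof. by move=> t; rewrite /thompson_x1_inv /thompson_x1; pieces_lra. Qed.

Lemma thompson_x1K : cancel (@thompson_x1 R) thompson_x1_inv.
Proof. by move=> t; rewrite /thompson_x1_inv /thompson_x1; pieces_lra. Qed.

Lemma dyadic_frac (m n : nat) : dyadic (m%:R / 2 ^+ n : R).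
Proof. by exists m%:Z, n. Qed.

Lemma power_of_2_half : powers_of_2 (1 / 2 : R).
Proof. by exists (-1); rewrite exprN1 div1r. Qed.

Lemma power_of_2_1 : powers_of_2 (1 : R).
Proof. by exists 0; rewrite expr0z. Qed.

Lemma power_of_2_2 : powers_of_2 (2 : R).
Proof. by exists 1; rewrite expr1z. Qed.

Local Ltac piece_tac al be S :=
  exists al, be; split; [exact: S|];
  move=> t; rewrite in_itv/= => /andP[? ?]; pieces_lra.

Lemma thompsonF_x0 : thompsonF (@thompson_x0 R).
Proof.
apply: (@thompsonF_of_partition _ _ thompson_x0_inv [:: 1 / 2; 3 / 4; 1]).
- by move=> s t _ _ ?; rewrite /thompson_x0; pieces_lra.
- by move=> t; rewrite !in_itv/= /thompson_x0 => /andP[? ?]; pieces_lra.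
- by move=> t; rewrite !in_itv/= /thompson_x0_inv => /andP[? ?]; pieces_lra.
- by move=> t _; exact: thompson_x0_invK.
- by split; rewrite //= !andbT; apply/and3P; split; lra.
- move=> t; rewrite !inE => /or3P[] /eqP ->.
  + exact: (dyadic_frac 1 1).
  + by have := dyadic_frac 3 2; congr dyadic; field.
  + by have := dyadic_frac 1 0; congr dyadic; field.
- rewrite /thompson_x0; case=> [|[|[|//]]] _ /=.
  + piece_tac (1 / 2 : R) (0 : R) power_of_2_half.
  + piece_tac (1 : R) (- (1 / 4) : R) power_of_2_1.
  + piece_tac (2 : R) (-1 : R) power_of_2_2.
Qed.

Lemma thompsonF_x0_inv : thompsonF thompson_x0_inv.
Proof.
apply: (@thompsonF_of_partition _ _ (@thompson_x0 R) [:: 1 / 4; 1 / 2; 1]).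
- by move=> s t _ _ ?; rewrite /thompson_x0_inv; pieces_lra.
- by move=> t; rewrite !in_itv/= /thompson_x0_inv => /andP[? ?]; pieces_lra.
- by move=> t; rewrite !in_itv/= /thompson_x0 => /andP[? ?]; pieces_lra.
- by move=> t _; exact: thompson_x0K.
- by split; rewrite //= !andbT; apply/and3P; split; lra.
- move=> t; rewrite !inE => /or3P[] /eqP ->.
  + by have := dyadic_frac 1 2; congr dyadic; field.
  + exact: (dyadic_frac 1 1).
  + by have := dyadic_frac 1 0; congr dyadic; field.
- rewrite /thompson_x0_inv; case=> [|[|[|//]]] _ /=.
  + piece_tac (2 : R) (0 : R) power_of_2_2.
  + piece_tac (1 : R) (1 / 4 : R) power_of_2_1.
  + piece_tac (1 / 2 : R) (1 / 2 : R) power_of_2_half.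
Qed.

Lemma thompsonF_x1_inv : thompsonF thompson_x1_inv.
Proof.
apply: (@thompsonF_of_partition _ _ (@thompson_x1 R)
  [:: 1 / 2; 5 / 8; 3 / 4; 1]).
- by move=> s t _ _ ?; rewrite /thompson_x1_inv; pieces_lra.
- by move=> t; rewrite !in_itv/= /thompson_x1_inv => /andP[? ?]; pieces_lra.
- by move=> t; rewrite !in_itv/= /thompson_x1 => /andP[? ?]; pieces_lra.
- by move=> t _; exact: thompson_x1K.
- by split; rewrite //= !andbT; apply/and4P; split; lra.
- move=> t; rewrite !inE => /or4P[] /eqP ->.
  + exact: (dyadic_frac 1 1).
  + by have := dyadic_frac 5 3; congr dyadic; field.
  + by have := dyadic_frac 3 2; congr dyadic; field.
  + by have := dyadic_frac 1 0; congr dyadic; field.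
- rewrite /thompson_x1_inv; case=> [|[|[|[|//]]]] _ /=.
  + piece_tac (1 : R) (0 : R) power_of_2_1.
  + piece_tac (2 : R) (- (1 / 2) : R) power_of_2_2.
  + piece_tac (1 : R) (1 / 8 : R) power_of_2_1.
  + piece_tac (1 / 2 : R) (1 / 2 : R) power_of_2_half.
Qed.

(** What a loop labelled [x1] reveals about the vertex that carries it. *)
Lemma thompson_x1_fixed t : 0 < t < 1 -> thompson_x1 t = t <-> t <= 1 / 2.
Proof.
move=> /andP[? ?]; split; first by rewrite /thompson_x1; pieces_lra.
by rewrite /thompson_x1 => ->.
Qed.

Lemma thompson_x0_inv_le_half t : thompson_x0_inv t <= 1 / 2 <-> t <= 1 / 4.
Proof. by rewrite /thompson_x0_inv; case_pieces; split=> ?; lra. Qed.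

Lemma thompson_x0_le_half t : thompson_x0 t <= 1 / 2 <-> t <= 3 / 4.
Proof. by rewrite /thompson_x0; case_pieces; split=> ?; lra. Qed.

Lemma thompson_x1_inv_le t : thompson_x1_inv t <= 3 / 4 <-> t <= 5 / 8.
Proof. by rewrite /thompson_x1_inv; case_pieces; split=> ?; lra. Qed.

Lemma thompson_x0_in01 t : (0 < thompson_x0 t < 1) = (0 < t < 1).
Proof.
by apply/idP/idP; rewrite /thompson_x0; case_pieces => /andP[? ?]; apply/andP;
  split; lra.
Qed.

Lemma thompson_x0_inv_in01 t : (0 < thompson_x0_inv t < 1) = (0 < t < 1).
Proof. by rewrite -thompson_x0_in01 thompson_x0_invK. Qed.

Lemma thompson_x1_inv_in01 t : (0 < thompson_x1_inv t < 1) = (0 < t < 1).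
Proof.
by apply/idP/idP; rewrite /thompson_x1_inv; case_pieces => /andP[? ?]; apply/andP;
  split; lra.
Qed.

Lemma thompson_x0_right t : 3 / 4 < t -> thompson_x0 t = 2 * t - 1.
Proof. by move=> ?; rewrite /thompson_x0; pieces_lra. Qed.

Lemma thompson_x0_inv_left t : t <= 1 / 4 -> thompson_x0_inv t = 2 * t.
Proof. by rewrite /thompson_x0_inv => ->. Qed.

Lemma thompson_x0_inv_middle t :
  1 / 4 < t -> t <= 1 / 2 -> thompson_x0_inv t = t + 1 / 4.
Proof. by move=> ? ?; rewrite /thompson_x0_inv; pieces_lra. Qed.

Lemma thompson_x1_inv_left t :
  1 / 2 < t -> t <= 5 / 8 -> thompson_x1_inv t = 2 * t - 1 / 2.
Proof. by move=> ? ?; rewrite /thompson_x1_inv; pieces_lra. Qed.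

Lemma thompson_x1_inv_middle t :
  5 / 8 < t -> t <= 3 / 4 -> thompson_x1_inv t = t + 1 / 8.
Proof. by move=> ? ?; rewrite /thompson_x1_inv; pieces_lra. Qed.

(** * Magnifying the gap between inseparable points *)

(** [L] abstracts the pairs of vertices matched by an isomorphism of Schreier
    graphs: moving both points by the same letter keeps them related, and
    related points are never on different sides of [1/2]. *)
Section Doubling.
Variable L : R -> R -> Prop.
Hypothesis L_in01 : forall a b, L a b -> 0 < a < 1 /\ 0 < b < 1.
Hypothesis L_half : forall a b, L a b -> a <= 1 / 2 <-> b <= 1 / 2.
Hypothesis L_x0 : forall a b, L a b -> L (thompson_x0 a) (thompson_x0 b).
Hypothesis L_x0_inv :
  forall a b, L a b -> L (thompson_x0_inv a) (thompson_x0_inv b).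
Hypothesis L_x1_inv :
  forall a b, L a b -> L (thompson_x1_inv a) (thompson_x1_inv b).

Let doubles a b := exists a' b', L a' b' /\ a' - b' = 2 * (a - b).

(** On [(1/2, 3/4]] one applies [x1^-1], of slope [2] up to [5/8]; beyond it
    [x1^-1] is a translation into [(3/4, 7/8]], where [x0] has slope [2].  The
    pair cannot straddle [5/8], which [x0 \o x1^-1] sends to [1/2]. *)
Lemma double_gap_middle a b :
  L a b -> 1 / 2 < a <= 3 / 4 -> 1 / 2 < b <= 3 / 4 -> doubles a b.
Proof.
move=> Lab /andP[a1 a2] /andP[b1 b2]; have L1 := L_x1_inv Lab.
have := L_half (L_x0 L1); rewrite !thompson_x0_le_half !thompson_x1_inv_le => h.
have [a5|a5] := leP a (5 / 8).
  have b5 := h.1 a5; exists (thompson_x1_inv a), (thompson_x1_inv b); split=> //.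
  by rewrite !thompson_x1_inv_left//; ring.
have b5 : 5 / 8 < b by rewrite ltNge; apply/negP => /h.2; rewrite leNgt a5.
exists (thompson_x0 (thompson_x1_inv a)), (thompson_x0 (thompson_x1_inv b)).
split; first exact: L_x0.
rewrite !thompson_x1_inv_middle// !thompson_x0_right; last 2 first; lra.
Qed.

(** The maps [x0^-1] and [x0] send [1/4] and [3/4] to [1/2], so neither [1/4]
    nor [3/4] separates the pair.  On [(0, 1/4]] and [(3/4, 1)] the slope of [x0^-1],
    respectively [x0], is [2]; on [(1/4, 1/2]] the translation [x0^-1] leads to
    the middle interval. *)
Lemma double_gap a b : L a b -> doubles a b.
Proof.
move=> Lab; have [/andP[a0 a1] /andP[b0 b1]] := L_in01 Lab.
have L0 := L_x0 Lab; have L0' := L_x0_inv Lab.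
have h2 := L_half Lab; have := L_half L0; have := L_half L0'.
rewrite !thompson_x0_le_half !thompson_x0_inv_le_half => h1 h3.
have [a2|a2] := leP a (1 / 2).
  have b2 := h2.1 a2; have [a4|a4] := leP a (1 / 4).
    have b4 := h1.1 a4; exists (thompson_x0_inv a), (thompson_x0_inv b).
    by split=> //; rewrite !thompson_x0_inv_left//; ring.
  have b4 : 1 / 4 < b by rewrite ltNge; apply/negP => /h1.2; rewrite leNgt a4.
  rewrite !thompson_x0_inv_middle// in L0'.
  have [||a' [b' [L' d]]] := double_gap_middle L0'.
  - by apply/andP; split; lra.
  - by apply/andP; split; lra.
  - by exists a', b'; split=> //; lra.
have b2 : 1 / 2 < b by rewrite ltNge; apply/negP => /h2.2; rewrite leNgt a2.
have [a4|a4] := leP a (3 / 4).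
  by apply: double_gap_middle; rewrite // ?a2 ?b2 ?a4 ?h3.1.
have b4 : 3 / 4 < b by rewrite ltNge; apply/negP => /h3.2; rewrite leNgt a4.
exists (thompson_x0 a), (thompson_x0 b); split=> //.
by rewrite !thompson_x0_right//; ring.
Qed.

Lemma inseparable_eq a b : L a b -> a = b.
Proof.
move=> Lab; have {Lab} gap n : exists a' b', L a' b' /\ a' - b' = 2 ^+ n * (a - b).
  elim: n => [|n [a1 [b1 [/double_gap[a' [b' [L' d]]] d1]]]].
    by exists a, b; rewrite expr0 mul1r.
  by exists a', b'; split=> //; rewrite d d1 exprS mulrA.
have bound n : 2 ^+ n * `|a - b| < 1.
  have [a' [b' [/L_in01[/andP[? ?] /andP[? ?]] d]]] := gap n.
  have -> : 2 ^+ n * `|a - b| = `|a' - b'|.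
    by rewrite d normrM ger0_norm// exprn_ge0.
  by rewrite ltr_norml; apply/andP; split; lra.
apply/eqP; rewrite -subr_eq0 -normr_le0 leNgt; apply/negP => d0.
have := bound (Num.bound `|a - b|^-1); apply/negP; rewrite -leNgt -ler_pdivrMr//.
by rewrite div1r ltW// upper_nthrootP.
Qed.

End Doubling.
End Generators.

(** * Schreier graphs *)

Lemma thompson_orbit_closed (R : realType) (x z : R) (g : R -> R) :
  thompsonF g -> thompson_orbit x z -> thompson_orbit x (g z).
Proof.
by move=> Fg [f Ff <-]; exists (g \o f); [exact: thompsonF_comp|reflexivity].
Qed.

Theorem corollary5p5 (R : realType) (x y : R)
    (hx : 0 < x < 1) (hy : 0 < y < 1) (hxy : x <> y) :
  ~ pmg_isomorphic (schreier_graph x) (schreier_graph y).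
Proof.
move=> [phi [_ edgeE baseE]]; apply: hxy.
(* The endpoints [0] and [1] are excluded: [x1] fixes [1] as well. *)
pose L a b := exists u : vertex (schreier_graph x),
  [/\ val u = a, val (phi u) = b, 0 < a < 1 & 0 < b < 1].
have move_vertex g (u : vertex (schreier_graph x)) : thompsonF g ->
    exists v : vertex (schreier_graph x), val v = g (val u).
  move=> Fg; have /thompson_orbit_closed := set_valP u.
  by move=> /(_ _ Fg)/mem_set h; exists (SigSub h).
have Lhalf a b : L a b -> a <= 1 / 2 <-> b <= 1 / 2.
  move=> [u [ua ub a01 b01]]; have := edgeE X1 u u.
  by rewrite /= ua ub !thompson_x1_fixed.
have Lx0 a b : L a b -> L (thompson_x0 a) (thompson_x0 b).
  move=> [u [ua ub a01 b01]]; have [v vE] := move_vertex _ u (thompsonF_x0 R).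
  exists v; rewrite !thompson_x0_in01 vE ua; split=> //.
  by have := (edgeE X0 u v).1; rewrite /= vE ub => /(_ erefl).
have Lx0_inv a b : L a b -> L (thompson_x0_inv a) (thompson_x0_inv b).
  move=> [u [ua ub a01 b01]].
  have [v vE] := move_vertex _ u (thompsonF_x0_inv R).
  exists v; rewrite !thompson_x0_inv_in01 vE ua; split=> //.
  have := (edgeE X0 v u).1; rewrite /= vE ub thompson_x0_invK => /(_ erefl) <-.
  by rewrite thompson_x0K.
have Lx1_inv a b : L a b -> L (thompson_x1_inv a) (thompson_x1_inv b).
  move=> [u [ua ub a01 b01]].
  have [v vE] := move_vertex _ u (thompsonF_x1_inv R).
  exists v; rewrite !thompson_x1_inv_in01 vE ua; split=> //.
  have := (edgeE X1 v u).1; rewrite /= vE ub thompson_x1_invK => /(_ erefl) <-.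
  by rewrite thompson_x1K.
apply: (@inseparable_eq _ L) => //; first by move=> a b [u []].
exists (base (schreier_graph x)); split=> //.
by rewrite baseE.
Qed.
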